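(* Let $\mathfrak{g}=\mathfrak{gl}(p,q)$ and $k\ge 1$. Then the transgression of $P_k$ is $t(P_k)=(-1)^{k-1}\,k\,\Lambda_{2k-1}$.
   Context: Setup for a finite-dimensional complex Lie superalgebra $\mathfrak{g}=\mathfrak{g}_{\bar 0}\oplus\mathfrak{g}_{\bar 1}$; elements are homogeneous, lower-case letters denote their $\mathbb{Z}_2$-degrees. For $\mathcal{X}=(X_1,\dots,X_k)$ and $\sigma\in\mathfrak{S}_k$ let $\epsilon(\sigma,\mathcal{X})=(-1)^{K}$, $K$ the number of pairs $i<j$ with $\sigma(i)>\sigma(j)$ and $X_{\sigma(i)},X_{\sigma(j)}$ both odd. A $k$-linear form $F$ on $\mathfrak{g}$ has degree $f$ if $F(X_1,\dots,X_k)\neq0$ only when $x_1+\dots+x_k+f=0$ in $\mathbb{Z}_2$ (scalars are even). $F$ is supersymmetric if $\epsilon(\sigma,\mathcal{X})F(X_{\sigma(1)},\dots,X_{\sigma(k)})=F(X_1,\dots,X_k)$ for all $\sigma$, and skew supersymmetric if $\epsilon(\sigma)\epsilon(\sigma,\mathcal{X})F(X_{\sigma(1)},\dots)=F(X_1,\dots)$; $\mathcal{P}(\mathfrak{g})$, $\mathcal{A}(\mathfrak{g})$ denote the spaces of such forms (of all orders). Super tensor product: $(F\boxtimes G)(X_1,\dots,X_{a+b})=(-1)^{g(x_1+\dots+x_a)}F(X_1,\dots,X_a)G(X_{a+1},\dots,X_{a+b})$ for $F$ an $a$-form, $G$ a $b$-form of degree $g$. With $S(F)=\sum_\sigma\epsilon(\sigma,\mathcal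 X)F(X_{\sigma(1)},\dots)$ and $A(F)=\sum_\sigma\epsilon(\sigma)\epsilon(\sigma,\mathcal X)F(X_{\sigma(1)},\dots)$, set $F\cdot G=\frac1{a!b!}S(F\boxtimes G)$ on $\mathcal P(\mathfrak g)$ and $F\wedge G=\frac1{a!b!}A(F\boxtimes G)$ on $\mathcal A(\mathfrak g)$. For $X\in\mathfrak g$ and $F$ of degree $f$, $D_X(F)(X_1,\dots,X_{a-1})=(-1)^{xf}F(X,X_1,\dots,X_{a-1})$. The map $d:\mathcal A(\mathfrak g)\to\mathcal A(\mathfrak g)$ is the super derivation of $(\mathcal A(\mathfrak g),\wedge)$ raising the order by one, with $d\phi(X_1,X_2)=-\phi([X_1,X_2])$ for $\phi\in\mathfrak g^*$ (explicitly $dF(X_1,\dots,X_{m+1})=\sum_{i<j}(-1)^{i+j}(-1)^{x_i(x_1+\dots+x_{i-1})}(-1)^{x_j(x_1+\dots+\widehat{x_i}+\dots+x_{j-1})}F([X_i,X_j],X_1,\dots,\widehat{X_i},\dots,\widehat{X_j},\dots,X_{m+1})$). Let $s:\mathcal P(\mathfrak g)\to\mathcal A(\mathfrak g)$ be the algebra homomorphism with $s(\phi)=d\phi$ for $\phi\in\mathfrak g^*$. Choose a basis $X_1,\dots,X_m$ of $\mathfrak g_{\bar0}$ with dual basis $\Omega_1,\dots,\Omega_m$ and a basis $Y_1,\dots,Y_r$ of $\mathfrak g_{\bar1}$ with dual basis $\phi_1,\dots,\phi_r$. The transgression $t:\mathcal P(\mathfrak g)\to\mathcal A(\mathfrak g)$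 is $t(P)=\sum_i\Omega_i\wedge s(D_{X_i}P)-\sum_j\phi_j\wedge s(D_{Y_j}P)$ (basis independent). Now $\mathfrak g=\mathfrak{gl}(p,q)=\mathrm{End}(V)$, $V=V_{\bar0}\oplus V_{\bar1}$, $\dim V_{\bar0}=p$, $\dim V_{\bar1}=q$, with super trace $\mathrm{str}\begin{pmatrix}a&b\\c&d\end{pmatrix}=\mathrm{tr}(a)-\mathrm{tr}(d)$. For $k\ge1$ and homogeneous $X_i$: $\mathcal P_k(X_1,\dots,X_k)=\sum_{\sigma\in\mathfrak S_k}\epsilon(\sigma,\mathcal X)X_{\sigma(1)}\cdots X_{\sigma(k)}$, $\mathcal A_k(X_1,\dots,X_k)=\sum_\sigma\epsilon(\sigma)\epsilon(\sigma,\mathcal X)X_{\sigma(1)}\cdots X_{\sigma(k)}$ (matrix products), $P_k=\mathrm{str}\circ\mathcal P_k\in\mathcal P(\mathfrak g)$, $\Lambda_k=\mathrm{str}\circ\mathcal A_k\in\mathcal A(\mathfrak g)$. *)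

(* Defs.v *)
From HB Require Import structures.
From mathcomp Require Import all_boot all_order all_algebra all_fingroup.
Set Implicit Arguments. Unset Strict Implicit. Unset Printing Implicit Defensive.
Import GRing.Theory Num.Theory.
Local Open Scope ring_scope.

Section SuperForms.
Variables (C : numClosedFieldType) (p q : nat).
Local Notation n := (p + q)%N.
Local Notation M := 'M[C]_n.

(* parity of a basis vector of V = V_0 (+) V_1 : the first p are even *)
Definition ipar (i : 'I_n) : bool := (p <= i)%N.

(* the homogeneous component of degree b of X (true = odd) *)
Definition hpart (b : bool) (X : M) : M :=
  \matrix_(i, j) if (ipar i (+) ipar j) == b then X i j else 0.

Definition homog (Xb : M * bool) : bool := hpart Xb.2 Xb.1 == Xb.1.

Definition sgn (b : bool) : C := (-1) ^+ b.

Definition sbr (X Y : M * bool) : M * bool :=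
  (X.1 *m Y.1 - sgn (X.2 && Y.2) *: (Y.1 *m X.1), X.2 (+) Y.2).

Definition str (X : M) : C := \sum_(i < n) sgn (ipar i) * X i i.

(* A "sform" is a family of multilinear forms of all orders:
   F evaluated on a list of length k is its order-k component. *)
Definition sform := seq M -> C.
(* formulas on homogeneous arguments, each argument tagged with its degree *)
Definition hsform := seq (M * bool) -> C.

Definition psum (ys : seq (M * bool)) : bool := foldr addb false (map snd ys).

Definition ext (H : hsform) : sform := fun xs =>
  \sum_(b : {ffun 'I_(size xs) -> bool})
     H [seq (hpart (b i) (nth 0 xs i), b i) | i <- enum 'I_(size xs)].

Definition permute (T : Type) (d : T) (ys : seq T) (s : 'S_(size ys)) : seq T :=
  [seq nth d ys (s i) | i <- enum 'I_(size ys)].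

Definition hd0 : M * bool := (0, false).

Definition inv_odd (ys : seq (M * bool)) (s : 'S_(size ys)) : nat :=
  #|[set ij : 'I_(size ys) * 'I_(size ys) |
      [&& (ij.1 < ij.2)%N, (s ij.2 < s ij.1)%N,
          (nth hd0 ys (s ij.1)).2 & (nth hd0 ys (s ij.2)).2]]|.
Definition eps (ys : seq (M * bool)) (s : 'S_(size ys)) : C := (-1) ^+ inv_odd s.
Definition sgnp (k : nat) (s : 'S_k) : C := (-1) ^+ (odd_perm s).

(* super tensor product, F taking the first a arguments; the degree g of G is
   the total degree of its (homogeneous) arguments *)
Definition stensor (a : nat) (F G : sform) : hsform := fun ys =>
  sgn (psum (drop a ys) && psum (take a ys))
  * F (map fst (take a ys)) * G (map fst (drop a ys)).

Definition Ssym (H : hsform) : hsform := fun ys =>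
  \sum_(s : 'S_(size ys)) eps s * H (permute hd0 s).
Definition Asym (H : hsform) : hsform := fun ys =>
  \sum_(s : 'S_(size ys)) sgnp s * eps s * H (permute hd0 s).

(* F . G  and  F /\ G  (bilinearly extended to all orders) *)
Definition fprod (F G : sform) : sform := ext (fun ys =>
  \sum_(a < (size ys).+1)
     ((a`! * (size ys - a)`!)%:R)^-1 * Ssym (stensor a F G) ys).
Definition fwedge (F G : sform) : sform := ext (fun ys =>
  \sum_(a < (size ys).+1)
     ((a`! * (size ys - a)`!)%:R)^-1 * Asym (stensor a F G) ys).

(* D_X F, X homogeneous of degree x; the degree f of F is x + sum of degrees *)
Definition Dder (X : M) (x : bool) (F : sform) : sform := ext (fun ys =>
  sgn (x && (x (+) psum ys)) * F (X :: map fst ys)).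

Definition dd (F : sform) : sform := ext (fun ys =>
  \sum_(i < size ys) \sum_(j < size ys | (i < j)%N)
    (-1) ^+ (i + j)%N
    * sgn ((nth hd0 ys i).2 && psum (take i ys))
    * sgn ((nth hd0 ys j).2 && (psum (take j ys) (+) (nth hd0 ys i).2))
    * F ((sbr (nth hd0 ys i) (nth hd0 ys j)).1
         :: [seq (nth hd0 ys (val k)).1 | k <- [seq k : 'I_(size ys) <- enum 'I_(size ys) | (k != i) && (k != j)]])).

Definition unitf : sform := fun xs => if xs is [::] then 1 else 0.

Definition multilinear (F : sform) : Prop :=
  forall (xs ys : seq M) (c : C) (X Y : M),
    F (xs ++ (c *: X + Y) :: ys) = c * F (xs ++ X :: ys) + F (xs ++ Y :: ys).

Definition supersym (F : sform) : Prop :=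
  forall ys : seq (M * bool), all homog ys ->
    forall s : 'S_(size ys), eps s * F (map fst (permute hd0 s)) = F (map fst ys).

Definition inP (F : sform) : Prop := multilinear F /\ supersym F.

Definition is_s (s : sform -> sform) : Prop :=
  [/\ (forall (F G : sform) (c : C), inP F -> inP G ->
         forall xs, s (fun ys => c * F ys + G ys) xs = c * s F xs + s G xs),
      (forall F G : sform, inP F -> inP G ->
         forall xs, s (fprod F G) xs = fwedge (s F) (s G) xs),
      (forall xs, s unitf xs = unitf xs)
    & (forall phi : sform, multilinear phi -> (forall xs, size xs != 1%N -> phi xs = 0) ->
         forall xs, s phi xs = dd phi xs)].

Definition coordf (i j : 'I_n) : sform := fun xs => if xs is [:: X] then X i j else 0.

(* transgression, computed in the basis of elementary matrices E_ij
   (even iff ipar i = ipar j) *)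
Definition transg (s : sform -> sform) (P : sform) : sform := fun xs =>
  \sum_(i < n) \sum_(j < n)
    sgn (ipar i (+) ipar j)
    * fwedge (coordf i j) (s (Dder (delta_mx i j) (ipar i (+) ipar j) P)) xs.

Definition mprod (xs : seq M) : M := foldr mulmx 1%:M xs.

Definition Pk (k : nat) : sform := ext (fun ys =>
  if size ys == k then
    \sum_(s : 'S_(size ys)) eps s * str (mprod (map fst (permute hd0 s)))
  else 0).

Definition Lk (k : nat) : sform := ext (fun ys =>
  if size ys == k then
    \sum_(s : 'S_(size ys)) sgnp s * eps s * str (mprod (map fst (permute hd0 s)))
  else 0).

End SuperForms.

(* Main.v *)
Require Import Defs.
From HB Require Import structures.
From mathcomp Require Import all_boot all_order all_algebra all_fingroup.
From mathcomp Require Import boolp ring.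
Set Implicit Arguments. Unset Strict Implicit. Unset Printing Implicit Defensive.
Import GRing.Theory Num.Theory.
Local Open Scope ring_scope.

(** Matrix entries of symmetrised products multiply like matrices: if [Q_m^{ij}]
    (resp. [W_m^{ij}]) is the (skew) supersymmetrisation of
    [X_1, ..., X_m |-> (X_1 ... X_m)_{ij}], then, up to the Koszul sign of the
    homogeneous forms involved, [Q_(a+b)^{ij} = \sum_k Q_a^{ik} . Q_b^{kj}], and
    likewise for [W] and the wedge product.  The coordinate form [x_ij] is both
    [Q_1^{ij}] and [W_1^{ij}], and [d x_ij = - W_2^{ij}], so that an algebra
    morphism [s] extending [d] sends [Q_m^{ij}] to [(-1)^m W_(2m)^{ij}].
    Supercyclicity of the supertrace gives
    [D_{E_ij} P_k = (-1)^{|i|} k Q_(k-1)^{ji}], and the transgression becomes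
    [(-1)^(k-1) k \sum_{i,j} +/- x_ij /\ W_(2k-2)^{ji}
     = (-1)^(k-1) k Lambda_(2k-1)]. *)

(** * Koszul signs of permutations *)

Section KoszulSign.
Variable R : comNzRingType.

(** This is $\epsilon(\sigma,\mathcal X)$ for degrees given by a colouring [c]. Written as a product
    over pairs rather than as a power of an inversion count, it can be compared factor by factor. *)
Definition koszul k (c : 'I_k -> bool) (s : 'S_k) : R :=
  \prod_(i < k) \prod_(j < k) (-1) ^+ [&& i < j, s j < s i, c (s i) & c (s j)]%N.

Lemma eq_koszul k (c c' : 'I_k -> bool) (s : 'S_k) :
  c =1 c' -> koszul c s = koszul c' s.
Proof.
by move=> cc'; apply: eq_bigr => i _; apply: eq_bigr => j _; rewrite !cc'.
Qed.

Lemma prod_pairs_lt k (F : 'I_k -> 'I_k -> R) :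
  (forall i, F i i = 1) ->
  \prod_(i < k) \prod_(j < k) F i j = \prod_(i < k) \prod_(j < k | (i < j)%N) (F i j * F j i).
Proof.
move=> F1; transitivity (\prod_(i < k) \prod_(j < k) ((if (i < j)%N then F i j else 1)
    * (if (j < i)%N then F i j else 1))).
  apply: eq_bigr => i _; apply: eq_bigr => j _.
  case: ltngtP => [||ij]; rewrite ?mulr1 ?mul1r //.
  by rewrite (val_inj ij) F1.
under eq_bigr do rewrite big_split.
rewrite big_split /= [X in _ * X]exchange_big -big_split /=.
apply: eq_bigr => i _; rewrite -big_split /= [RHS]big_mkcond /=.
by apply: eq_bigr => j _; case: ifP => // _; rewrite mulr1.
Qed.

(** Cocycle identity, checked on each unordered pair: the composite inverts it exactly when one, and
    only one, of the two successive permutations does, and the colours tested are those of the final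
    images. *)
Lemma koszulM k (c : 'I_k -> bool) (t s : 'S_k) :
  koszul c (t * s)%g = koszul (c \o s) t * koszul c s.
Proof.
(* Reindexing the factor of [s] along [t] makes all three products run over the same pairs. *)
have -> : koszul c s = \prod_(i < k) \prod_(j < k)
    (-1) ^+ [&& t i < t j, s (t j) < s (t i), c (s (t i)) & c (s (t j))]%N.
  rewrite [LHS](reindex_inj (@perm_inj _ t)); apply: eq_bigr => i _.
  by rewrite (reindex_inj (@perm_inj _ t)).
rewrite /koszul !prod_pairs_lt; try by move=> i; rewrite !ltnn.
rewrite -big_split; apply: eq_bigr => i _ /=.
rewrite -big_split; apply: eq_bigr => j ij /=.
rewrite !permM -!signr_addb; congr (_ ^+ nat_of_bool _).
rewrite ij (ltnNge j i) (ltnW ij) /=.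
have ltN (u : 'I_k -> 'I_k) : injective u -> (u j < u i)%N = ~~ (u i < u j)%N.
  move=> u_inj; rewrite -leqNgt [RHS]leq_eqVlt (inj_eq val_inj) (inj_eq u_inj).
  by rewrite -val_eqE /= gtn_eqF.
rewrite !(ltN t) 1?(ltN (s \o t)) /=; try exact: perm_inj; last first.
  by move=> x y /perm_inj /perm_inj.
by case: (t i < t j)%N; case: (s (t i) < _)%N; case: (c _); case: (c _).
Qed.

(** * Permutations preserving two consecutive blocks *)

Definition block_fun a b (s : 'S_a) (t : 'S_b) (i : 'I_(a + b)) : 'I_(a + b) :=
  unsplit match split i with inl j => inl (s j) | inr j => inr (t j) end.

Lemma block_fun_inj a b (s : 'S_a) (t : 'S_b) : injective (block_fun s t).
Proof.
apply: (can_inj (g := block_fun s^-1 t^-1)) => i; rewrite /block_fun -[RHS]splitK.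
by case: (split i) => j; rewrite unsplitK permK.
Qed.

Definition block_perm a b (s : 'S_a) (t : 'S_b) : 'S_(a + b) :=
  perm (@block_fun_inj a b s t).

Lemma block_perm_lshift a b (s : 'S_a) (t : 'S_b) i :
  block_perm s t (lshift b i) = lshift b (s i).
Proof. by rewrite permE /block_fun -[lshift b i]/(unsplit (inl i)) unsplitK. Qed.

Lemma block_perm_rshift a b (s : 'S_a) (t : 'S_b) i :
  block_perm s t (rshift a i) = rshift a (t i).
Proof. by rewrite permE /block_fun -[rshift a i]/(unsplit (inr i)) unsplitK. Qed.

(** The sign of a permutation is the determinant of its matrix, which is block diagonal here; over
    [rat] the sign determines the parity. *)
Lemma odd_block_perm a b (s : 'S_a) (t : 'S_b) :
  odd_perm (block_perm s t) = odd_perm s (+) odd_perm t.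
Proof.
have : \det (perm_mx (block_perm s t)) = \det (perm_mx s) * \det (perm_mx t) :> rat.
  rewrite -(det_lblock _ 0); congr (\det _); apply/matrixP=> i j.
  have splitl j' : split (lshift b j') = inl j' := unsplitK (inl j').
  have splitr j' : split (rshift a j') = inr j' := unsplitK (inr j').
  rewrite !mxE; case: (split_ordP i) => i' ->; case: (split_ordP j) => j' ->;
  rewrite !mxE ?splitl ?splitr ?mxE ?block_perm_lshift ?block_perm_rshift -!val_eqE /=.
  - by [].
  - by rewrite ltn_eqF // ltn_addr.
  - by rewrite gtn_eqF // ltn_addr.
  - by rewrite eqn_add2l.
rewrite !det_perm -signr_addb => /eqP.
by rewrite (inj_eq (@signr_inj _)) => /eqP.
Qed.

(** A pair straddling the blocks keeps its order, so only pairs inside one block contribute. *)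
Lemma koszul_block a b (c : 'I_(a + b) -> bool) (s : 'S_a) (t : 'S_b) :
  koszul c (block_perm s t)
  = koszul (c \o @lshift a b) s * koszul (c \o @rshift a b) t.
Proof.
rewrite /koszul big_split_ord /=; congr (_ * _); apply: eq_bigr => i _;
rewrite big_split_ord /=.
  rewrite [X in _ * X]big1 ?mulr1 => [|j _].
    by apply: eq_bigr => j _; rewrite !block_perm_lshift.
  rewrite block_perm_lshift block_perm_rshift /=.
  by rewrite [X in _ && (X && _)]ltnNge (ltnW (ltn_addr _ (ltn_ord (s i)))) andbF.
rewrite [X in X * _]big1 ?mul1r => [|j _].
  by apply: eq_bigr => j _; rewrite !block_perm_rshift /= !ltn_add2l.
by rewrite /= [X in X && _]ltnNge (ltnW (ltn_addr _ (ltn_ord j))).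
Qed.

(* [b = false] weighs the supersymmetrisation, [b = true] the skew one. *)
Definition weight (b : bool) k (c : 'I_k -> bool) (s : 'S_k) : R :=
  (-1) ^+ (b && s) * koszul c s.

Lemma weightM b k (c : 'I_k -> bool) (t s : 'S_k) :
  weight b c (t * s)%g = weight b (c \o s) t * weight b c s.
Proof. by rewrite /weight koszulM odd_permM mulrACA -signr_addb; case: b. Qed.

Lemma weight_block b m n (c : 'I_(m + n) -> bool) (s : 'S_m) (t : 'S_n) :
  weight b c (block_perm s t)
  = weight b (c \o @lshift m n) s * weight b (c \o @rshift m n) t.
Proof.
by rewrite /weight koszul_block odd_block_perm mulrACA -signr_addb; case: b.
Qed.

End KoszulSign.

(** * Extension of forms from homogeneous arguments *)

Section Ext.
Variables (C : numClosedFieldType) (p q : nat).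
Local Notation n := (p + q)%N.
Local Notation M := 'M[C]_n.
Local Notation hd0 := (hd0 C p q).

Lemma homog_hpart b (X : M) : homog (hpart b X, b).
Proof.
by apply/eqP/matrixP=> i j; rewrite !mxE; case: eqP.
Qed.

Lemma hpart_linear b : linear (@hpart C p q b).
Proof.
by move=> c X Y; apply/matrixP=> i j; rewrite !mxE; case: eqP; rewrite ?mulr0 ?addr0.
Qed.

Lemma hpart_homog (y : M * bool) b :
  homog y -> hpart b y.1 = if b == y.2 then y.1 else 0.
Proof.
move=> /eqP ehom; case: eqP => [->//|nb]; rewrite -ehom.
apply/matrixP=> i j; rewrite !mxE.
by case: eqP nb => // ->; case: eqP => // ->.
Qed.

Lemma hpartD (X : M) : hpart true X + hpart false X = X.
Proof.
by apply/matrixP=> i j; rewrite !mxE; case: (_ (+) _); rewrite /= ?addr0 ?add0r.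
Qed.

Lemma eq_ext (H H' : hsform C p q) (xs : seq M) :
  (forall ys, all (@homog C p q) ys -> size ys = size xs -> H ys = H' ys) ->
  ext H xs = ext H' xs.
Proof.
move=> HH; apply: eq_bigr => b _; apply: HH; last by rewrite size_map size_enum_ord.
by rewrite all_map; apply/allP=> i _ /=; apply: homog_hpart.
Qed.

Lemma ext_nil (H : hsform C p q) : ext H [::] = H [::].
Proof.
rewrite /ext (big_pred1 [ffun=> false]) ?enum_ord0 // => b.
by apply/esym/eqP/ffunP; case.
Qed.

(** Choosing degrees for a nonempty list amounts to choosing one for its head and then for its tail;
    inductions on the arguments rest on this. *)
Lemma ext_cons (H : hsform C p q) (x : M) (xs : seq M) :
  ext H (x :: xs) = \sum_(b : bool) ext (fun ys => H ((hpart b x, b) :: ys)) xs.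
Proof.
rewrite [RHS]pair_big /=.
pose h (bf : bool * {ffun 'I_(size xs) -> bool}) : {ffun 'I_(size xs).+1 -> bool} :=
  [ffun i => if unlift ord0 i is Some j then bf.2 j else bf.1].
pose h' (f : {ffun 'I_(size xs).+1 -> bool}) :=
  (f ord0, [ffun j => f (lift ord0 j)]).
rewrite /ext (reindex h) /=; last first.
  exists h' => [[b f] _|f _]; rewrite /h /h'.
    by rewrite ffunE unlift_none; congr pair; apply/ffunP=> j; rewrite !ffunE liftK.
  by apply/ffunP=> i; rewrite ffunE; case: unliftP => [j|] ->; rewrite ?ffunE.
apply: eq_bigr => -[b f] _; congr H; rewrite enum_ordSl /= ffunE unlift_none.
by congr cons; rewrite -map_comp; apply: eq_map => j /=; rewrite ffunE liftK.
Qed.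

(** A homogeneous argument has a zero component in the other degree. This condition kills the
    corresponding terms of [ext], whatever their tag. *)
Definition vanishing (H : hsform C p q) :=
  forall us vs b, H (us ++ (0, b) :: vs) = 0.

Lemma ext0 (xs : seq M) : ext (fun=> 0) xs = 0 :> C.
Proof. exact: big1. Qed.

Lemma ext_homog (H : hsform C p q) ys :
  vanishing H -> all (@homog C p q) ys -> ext H (map fst ys) = H ys.
Proof.
elim: ys H => [|y ys IHys] H H0 /=; first by rewrite ext_nil.
case/andP=> hy hys; rewrite ext_cons.
rewrite (bigD1 y.2) //= big1 ?addr0 => [|b /negPf nb].
  rewrite IHys // => [|us vs b]; last by rewrite -cat_cons H0.
  by rewrite hpart_homog // eqxx; case: (y).
rewrite hpart_homog // nb -(ext0 (map fst ys)).
by apply: eq_ext => zs _ _; rewrite -[_ :: _]cat0s H0.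
Qed.

Lemma extD (H H' : hsform C p q) c xs :
  ext (fun ys => c * H ys + H' ys) xs = c * ext H xs + ext H' xs.
Proof. by rewrite /ext big_split mulr_sumr. Qed.

Lemma extZ (H : hsform C p q) c xs :
  ext (fun ys => c * H ys) xs = c * ext H xs.
Proof. by rewrite /ext mulr_sumr. Qed.

Lemma ext_sum (I : finType) (H : I -> hsform C p q) xs :
  ext (fun ys => \sum_i H i ys) xs = \sum_i ext (H i) xs.
Proof. by rewrite /ext exchange_big. Qed.

Definition hmultilinear (H : hsform C p q) := forall us vs b c (X Y : M),
  H (us ++ (c *: X + Y, b) :: vs) = c * H (us ++ (X, b) :: vs) + H (us ++ (Y, b) :: vs).

Lemma hmultilinear_vanishing H : hmultilinear H -> vanishing H.
Proof.
move=> Hlin us vs b; have := Hlin us vs b 1 0 0.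
rewrite scaler0 addr0 mul1r => /eqP.
by rewrite -subr_eq0 opprD addNKr oppr_eq0 => /eqP.
Qed.

Lemma ext_multilinear H : hmultilinear H -> multilinear (ext H).
Proof.
move=> Hlin xs ys c X Y; elim: xs H Hlin => [|x xs IHxs] H Hlin /=.
  rewrite !ext_cons mulr_sumr -big_split; apply: eq_bigr => b _ /=.
  rewrite -extD; apply: eq_ext => zs _ _; rewrite hpart_linear.
  exact: (Hlin [::]).
rewrite !ext_cons mulr_sumr -big_split; apply: eq_bigr => b _ /=.
apply: IHxs => us vs b' c' X' Y'; exact: (Hlin (_ :: us)).
Qed.

End Ext.

(** * Supersymmetrisation *)

Section Symmetrisation.
Variables (C : numClosedFieldType) (p q : nat).
Local Notation n := (p + q)%N.
Local Notation M := 'M[C]_n.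
Local Notation hd0 := (hd0 C p q).
Local Notation homogs := (all (@homog C p q)).

Definition tags k (ys : seq (M * bool)) (i : 'I_k) : bool := (nth hd0 ys i).2.

(** Unlike in [permute], the length [k] is independent of the list, so no permutation has to be
    transported along an equality of sizes. *)
Definition permk k (ys : seq (M * bool)) (s : 'S_k) : seq (M * bool) :=
  [seq nth hd0 ys (s i) | i <- enum 'I_k].

Definition wsum (b : bool) k (H : hsform C p q) : hsform C p q := fun ys =>
  \sum_(s : 'S_k) weight C b (tags ys) s * H (permk ys s).

Lemma size_permk k ys (s : 'S_k) : size (permk ys s) = k.
Proof. by rewrite size_map size_enum_ord. Qed.

Lemma nth_permk k ys (s : 'S_k) (i : 'I_k) : nth hd0 (permk ys s) i = nth hd0 ys (s i).
Proof. by rewrite (nth_map i) ?size_enum_ord ?nth_ord_enum. Qed.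

Lemma tags_permk k ys (s : 'S_k) : tags (permk ys s) =1 tags ys \o s.
Proof. by move=> i; rewrite /tags nth_permk. Qed.

Lemma permkM k ys (t s : 'S_k) : permk ys (t * s)%g = permk (permk ys s) t.
Proof. by apply: eq_map => i; rewrite nth_permk permM. Qed.

Lemma homog_permk k ys (s : 'S_k) : homogs ys -> size ys = k -> homogs (permk ys s).
Proof.
move=> hys sys; rewrite all_map; apply/allP=> i _ /=.
by move/all_nthP: hys; apply; rewrite sys.
Qed.

Lemma perm_permk k ys (s : 'S_k) : size ys = k -> perm_eq (permk ys s) ys.
Proof.
move=> sys; have -> : permk ys s = map (fun i : 'I_k => nth hd0 ys i) (map s (enum 'I_k)).
  by rewrite -map_comp.
have {2}-> : ys = map (fun i : 'I_k => nth hd0 ys i) (enum 'I_k).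
  by rewrite (map_comp (nth hd0 ys) val) val_enum_ord -sys map_nth_iota0 ?take_size.
apply/perm_map/uniq_perm; rewrite ?enum_uniq ?(map_inj_uniq (@perm_inj _ s)) //.
  exact: enum_uniq.
move=> i; rewrite mem_enum; apply/mapP; exists (s^-1%g i); last by rewrite permKV.
by rewrite mem_enum.
Qed.

Lemma epsE (ys : seq (M * bool)) (s : 'S_(size ys)) : eps s = koszul C (tags ys) s.
Proof.
rewrite /eps /koszul pair_big /= /inv_odd -sum1_card big_mkcond expr_sum.
by apply: eq_bigr => ij _; rewrite inE /tags; case: ifP.
Qed.

(** Right translation by [s] in the symmetric group, with the cocycle identity: a symmetrised form
    is (skew) supersymmetric. *)
Lemma wsumM b k H ys (s : 'S_k) :
  weight C b (tags ys) s * wsum b k H (permk ys s) = wsum b k H ys.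
Proof.
rewrite /wsum [RHS](reindex_inj (mulIg s)) mulr_sumr; apply: eq_bigr => t _.
rewrite weightM permkM mulrA [_ * weight _ _ _ t]mulrC.
by congr (_ * _ * _); congr (_ * _); apply: eq_koszul => i; rewrite tags_permk.
Qed.

(** Left translation, dually: a weighted permutation applied inside the symmetrisation disappears.
    This is what collapses nested symmetrisations. *)
Lemma wsum_absorb b k H ys (s : 'S_k) :
  wsum b k (fun zs => weight C b (tags zs) s * H (permk zs s)) ys = wsum b k H ys.
Proof.
rewrite /wsum [RHS](reindex_inj (mulgI s)); apply: eq_bigr => t _.
rewrite weightM permkM mulrA [_ * weight _ _ _ s]mulrC.
by congr (_ * _ * _); congr (_ * _); apply: eq_koszul => i; rewrite tags_permk.
Qed.

Definition gprod (b : bool) (F G : sform C p q) : sform C p q := ext (fun ys =>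
  \sum_(a < (size ys).+1)
     ((a`! * (size ys - a)`!)%:R)^-1 * wsum b (size ys) (stensor a F G) ys).

Lemma fprod_gprod F G : Defs.fprod F G = gprod false F G.
Proof.
apply: funext => xs; apply: eq_ext => ys _ _; apply: eq_bigr => a _; congr (_ * _).
by apply: eq_bigr => s _; rewrite epsE /weight mul1r.
Qed.

Lemma fwedge_gprod F G : fwedge F G = gprod true F G.
Proof.
apply: funext => xs; apply: eq_ext => ys _ _; apply: eq_bigr => a _; congr (_ * _).
by apply: eq_bigr => s _; rewrite epsE.
Qed.

Definition hform (b : bool) (k : nat) (H : hsform C p q) : hsform C p q :=
  fun ys => if size ys == k then wsum b k H ys else 0.

Definition wform b (k : nat) H : sform C p q := ext (hform b k H).

Lemma eq_wsum b k H H' ys : homogs ys -> size ys = k ->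
  (forall zs, homogs zs -> size zs = k -> H zs = H' zs) ->
  wsum b k H ys = wsum b k H' ys.
Proof.
move=> hys sys HH; apply: eq_bigr => s _; congr (_ * _).
by apply: HH; rewrite ?size_permk ?homog_permk.
Qed.

Lemma eq_wform b k H H' :
  (forall zs, homogs zs -> size zs = k -> H zs = H' zs) -> wform b k H = wform b k H'.
Proof.
move=> HH; apply: funext => xs; apply: eq_ext => ys hys _.
by rewrite /hform; case: eqP => // sys; apply: eq_wsum.
Qed.

Lemma wform_sum (I : finType) b k (H : I -> hsform C p q) (c : I -> C) xs :
  wform b k (fun ys => \sum_i c i * H i ys) xs = \sum_i c i * wform b k (H i) xs.
Proof.
rewrite /wform; under [RHS]eq_bigr do rewrite -extZ.
rewrite -ext_sum; apply: eq_ext => ys _ _; rewrite /hform /wsum.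
case: eqP => _; last by rewrite big1 // => i _; rewrite mulr0.
under [RHS]eq_bigr do rewrite mulr_sumr.
rewrite exchange_big; apply: eq_bigr => s _ /=; rewrite mulr_sumr.
by apply: eq_bigr => i _; rewrite mulrCA.
Qed.

(** The arguments around [y] after permuting do not depend on [y], so symmetrising preserves
    multilinearity. *)
Lemma permk_insert k us vs (s : 'S_k) : (size us < k)%N ->
  exists us' vs', forall y, permk (us ++ y :: vs) s = us' ++ y :: vs'.
Proof.
(* [r] is the position where the permutation puts [y]; in [L] a dummy occupies it. *)
move=> lt_us; pose r := s^-1%g (Ordinal lt_us); pose L := permk (us ++ hd0 :: vs) s.
exists (take r L), (drop r.+1 L) => y.
have sL : size L = k by rewrite size_permk.
have -> : take r L ++ y :: drop r.+1 L = set_nth hd0 L r y by rewrite set_nthE sL ltn_ord.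
apply: (@eq_from_nth _ hd0) => [|i].
  by rewrite size_set_nth !size_permk; apply/esym/maxn_idPr.
rewrite size_permk => ik; rewrite nth_set_nth /=.
rewrite -[i]/(val (Ordinal ik)) !nth_permk (inj_eq val_inj).
have nthy j : nth hd0 (us ++ y :: vs) j
    = if j == size us then y else nth hd0 (us ++ hd0 :: vs) j.
  rewrite !nth_cat; case: ltngtP => // [lt_j|->]; last by rewrite subnn.
  by rewrite -(subnSK lt_j).
rewrite nthy -[size us]/(val (Ordinal lt_us)) (inj_eq val_inj).
by rewrite -(inj_eq (@perm_inj _ s) _ r) permKV.
Qed.


Lemma tags_insert k us vs b (X Y : M) (i : 'I_k) :
  tags (us ++ (X, b) :: vs) i = tags (us ++ (Y, b) :: vs) i.
Proof. by rewrite /tags !nth_cat; case: ltnP => // _; case: (_ - _)%N. Qed.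

Lemma hform_multilinear b k H : hmultilinear H -> hmultilinear (hform b k H).
Proof.
move=> Hlin us vs t c X Y; rewrite /hform !size_cat /=.
case: eqP => [sk|_]; last by rewrite mulr0 addr0.
rewrite /wsum mulr_sumr -big_split; apply: eq_bigr => s _ /=.
have [|us' [vs' E]] := @permk_insert k us vs s; first by rewrite -sk addnS ltnS leq_addr.
rewrite !E Hlin mulrDr mulrCA; congr (_ * (_ * _) + _ * _).
  by congr (_ * _); apply: eq_koszul => i; apply: tags_insert.
by congr (_ * _); apply: eq_koszul => i; apply: tags_insert.
Qed.

Lemma wform_homog b k H ys : hmultilinear H -> homogs ys ->
  wform b k H (map fst ys) = hform b k H ys.
Proof.
by move=> Hlin hys; apply: ext_homog => //; apply/hmultilinear_vanishing/hform_multilinear.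
Qed.

Lemma wform_inP k H : hmultilinear H -> inP (wform false k H).
Proof.
move=> Hlin; split; first exact/ext_multilinear/hform_multilinear.
move=> ys hys s; rewrite -[permute _ _]/(permk ys s).
rewrite !wform_homog ?homog_permk // /hform size_permk epsE.
case: eqP => [<-|_]; last by rewrite mulr0.
by rewrite -(wsumM false H ys s) /weight mul1r.
Qed.

(** * Products of symmetrised forms *)

Definition htensor a (H1 H2 : hsform C p q) : hsform C p q := fun ys =>
  (-1) ^+ (psum (drop a ys) && psum (take a ys)) * H1 (take a ys) * H2 (drop a ys).

Lemma psum_perm (ys zs : seq (M * bool)) : perm_eq ys zs -> psum ys = psum zs.
Proof.
have psumE us : psum us = \big[addb/false]_(u <- us) u.2.
  by elim: us => [|u us IHus]; rewrite ?big_nil // big_cons -IHus.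
by rewrite !psumE; apply: perm_big.
Qed.

Lemma permk_block m l ys (s : 'S_m) (t : 'S_l) : size ys = (m + l)%N ->
  permk ys (block_perm s t) = permk (take m ys) s ++ permk (drop m ys) t.
Proof.
move=> sys; apply: (@eq_from_nth _ hd0) => [|i].
  by rewrite size_cat !size_permk.
rewrite size_permk => il; rewrite -[i]/(val (Ordinal il)) nth_permk.
rewrite nth_cat size_permk; case: (split_ordP (Ordinal il)) => j ->.
  by rewrite block_perm_lshift nth_permk nth_take /=.
by rewrite block_perm_rshift /= addKn nth_permk nth_drop.
Qed.

(** A pair of permutations is one block permutation, with multiplicative weight; the tensor sign
    depends only on the total degrees of the two halves, which permuting inside them preserves. *)
Lemma wsum_htensor b m l H1 H2 ys : size ys = (m + l)%N ->
  (-1) ^+ (psum (drop m ys) && psum (take m ys))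
    * wsum b m H1 (take m ys) * wsum b l H2 (drop m ys)
  = \sum_(s : 'S_m) \sum_(t : 'S_l) weight C b (tags ys) (block_perm s t)
      * htensor m H1 H2 (permk ys (block_perm s t)).
Proof.
move=> sys; rewrite /wsum -mulrA mulr_suml mulr_sumr; apply: eq_bigr => s _.
rewrite !mulr_sumr; apply: eq_bigr => t _.
have st : size (take m ys) = m by rewrite size_takel // sys leq_addr.
have sd : size (drop m ys) = l by rewrite size_drop sys addKn.
rewrite permk_block // /htensor take_size_cat ?drop_size_cat ?size_permk //.
rewrite (psum_perm (perm_permk s st)) (psum_perm (perm_permk t sd)) weight_block.
have -> : weight C b (tags (take m ys)) s = weight C b (tags ys \o @lshift m l) s.
  by congr (_ * _); apply: eq_koszul => i; rewrite /tags nth_take /=.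
have -> : weight C b (tags (drop m ys)) t = weight C b (tags ys \o @rshift m l) t.
  by congr (_ * _); apply: eq_koszul => i; rewrite /tags nth_drop /=.
by ring.
Qed.

(** The tensor product of the symmetrised forms is a sum over block permutations, each absorbed by
    the outer symmetrisation; the resulting $m!\,l!$ equal terms cancel the normalisation. *)
Lemma gprod_wform b (m l : nat) H1 H2 : hmultilinear H1 -> hmultilinear H2 ->
  gprod b (wform b m H1) (wform b l H2) = wform b (m + l)%N (htensor m H1 H2).
Proof.
move=> lin1 lin2; apply: funext => xs; apply: eq_ext => ys hys _.
have stE a zs : homogs zs -> stensor a (wform b m H1) (wform b l H2) zs =
    (-1) ^+ (psum (drop a zs) && psum (take a zs))
    * hform b m H1 (take a zs) * hform b l H2 (drop a zs).
  move=> hzs; have := hzs; rewrite -{1}(cat_take_drop a zs) all_cat => /andP[ht hd].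
  by rewrite /stensor !wform_homog.
(* Only the cut into lengths exactly [m] and [l] contributes. *)
have st0 a : (a <= size ys)%N -> ~~ ((a == m) && (size ys - a == l)%N) ->
    wsum b (size ys) (stensor a (wform b m H1) (wform b l H2)) ys = 0.
  move=> aE nE; rewrite (@eq_wsum _ _ _ (fun=> 0)) // => [|zs hzs szs].
    by apply: big1 => s _; rewrite mulr0.
  rewrite stE // /hform size_takel ?szs // size_drop szs.
  by move: nE; rewrite negb_and => /orP[]/negPf ->; rewrite ?(mulr0, mul0r).
rewrite /hform; case: eqP => [sys|nsys]; last first.
  rewrite big1 // => a _; rewrite st0 ?mulr0 // -1?ltnS //.
  apply: contra_notN nsys => /andP[/eqP <- /eqP <-].
  by rewrite subnKC // -ltnS.
have m_lt : (m < (size ys).+1)%N by rewrite ltnS sys leq_addr.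
rewrite (bigD1 (Ordinal m_lt)) //= [X in _ + X]big1 ?addr0 => [|a na]; last first.
  by rewrite st0 ?mulr0 // -1?ltnS // negb_and; move: na; rewrite -val_eqE /= => ->.
rewrite sys addKn (@eq_wsum _ _ _ (fun zs => \sum_(s : 'S_m) \sum_(t : 'S_l)
    weight C b (tags zs) (block_perm s t)
      * htensor m H1 H2 (permk zs (block_perm s t)))) // => [|zs hzs szs].
  rewrite /wsum; under eq_bigr do rewrite mulr_sumr.
  (* Moving both block sums outside exposes, for each block permutation, a full symmetrisation to
     which [wsum_absorb] applies. *)
  rewrite exchange_big; under eq_bigr => s _ do
    under eq_bigr => u _ do rewrite mulr_sumr.
  under eq_bigr => s _ do (rewrite exchange_big; under eq_bigr => t _ do
     rewrite -/(wsum b (m + l)%N (fun zs => weight C b (tags zs) (block_perm s t)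
      * htensor m H1 H2 (permk zs (block_perm s t))) ys) wsum_absorb).
  rewrite !sumr_const -mulrnA -[X in _ * X]mulr_natl mulrA !card_Sn mulnC mulVf ?mul1r //.
  by rewrite pnatr_eq0 -lt0n muln_gt0 !fact_gt0.
rewrite stE // /hform size_takel ?size_drop ?szs ?leq_addr // addKn !eqxx.
exact: wsum_htensor.
Qed.

End Symmetrisation.

(** * Matrix entries of products *)

Section MatrixEntries.
Variables (C : numClosedFieldType) (p q : nat).
Local Notation n := (p + q)%N.
Local Notation M := 'M[C]_n.
Local Notation homogs := (all (@homog C p q)).
Local Notation par i j := (@ipar p q i (+) @ipar p q j).

Definition entry (i j : 'I_n) : hsform C p q := fun ys => mprod (map fst ys) i j.

Lemma mprod_cat (xs ys : seq M) : mprod (xs ++ ys) = mprod xs *m mprod ys.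
Proof. by elim: xs => [|x xs IHxs] /=; rewrite ?mul1mx // IHxs mulmxA. Qed.

Lemma entry_multilinear i j : hmultilinear (entry i j).
Proof.
move=> us vs b c X Y; rewrite /entry !map_cat !mprod_cat /=.
by rewrite mulmxDl mulmxDr -scalemxAl -scalemxAr !mxE.
Qed.

Lemma homog_entry0 (X : M) b i j : homog (X, b) -> par i j != b -> X i j = 0.
Proof. by move=> /eqP /= <- /negPf nb; rewrite mxE nb. Qed.

Lemma homog_mulmx (X Y : M) b c :
  homog (X, b) -> homog (Y, c) -> homog (X *m Y, b (+) c).
Proof.
move=> hX hY; apply/eqP/matrixP=> i j; rewrite !mxE; case: eqP => // /eqP nbc.
rewrite big1 // => k _; have [ik|] := eqVneq (par i k) b; last first.
  by move=> nb; rewrite (homog_entry0 hX nb) mul0r.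
rewrite (homog_entry0 hY) ?mulr0 //; apply: contra nbc => /eqP <-.
by rewrite -ik addbA addbK.
Qed.

Lemma homog_mprod ys : homogs ys -> homog (mprod (map fst ys), psum ys).
Proof.
elim: ys => [|[X b] ys IHys] /=; last first.
  by case/andP=> hX /IHys; apply: homog_mulmx.
by move=> _; apply/eqP/matrixP=> i j; rewrite !mxE; case: (eqVneq i j) => [->|_];
   rewrite ?addbb //=; case: ifP.
Qed.

(** On nonzero terms, this lets signs in the degrees of the arguments be traded for signs in the
    matrix indices. *)
Lemma entry0 ys i j : homogs ys -> par i j != psum ys -> entry i j ys = 0.
Proof. by move=> /homog_mprod /homog_entry0; apply. Qed.

Lemma entry_cat m i j ys : homogs ys ->
  entry i j ys = \sum_k (-1) ^+ (par i k && par k j)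
     * htensor m (entry i k) (entry k j) ys.
Proof.
move=> hys; have := hys; rewrite -{1}(cat_take_drop m ys) all_cat => /andP[ht hd].
rewrite /entry -{1}(cat_take_drop m ys) map_cat mprod_cat mxE; apply: eq_bigr => k _.
rewrite /htensor -/(entry i k _) -/(entry k j _).
have [ik|] := eqVneq (par i k) (psum (take m ys)); last first.
  by move=> /(entry0 ht) ->; rewrite !(mulr0, mul0r).
have [kj|] := eqVneq (par k j) (psum (drop m ys)); last first.
  by move=> /(entry0 hd) ->; rewrite !(mulr0, mul0r).
by rewrite -ik -kj andbC !mulrA -signr_addb addbb mul1r.
Qed.

Lemma wform_entry_mul b (m l : nat) i j xs :
  \sum_k (-1) ^+ (par i k && par k j)
    * gprod b (wform b m (entry i k)) (wform b l (entry k j)) xs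
  = wform b (m + l)%N (entry i j) xs.
Proof.
under eq_bigr => k _ do
  rewrite (gprod_wform b m l (@entry_multilinear i k) (@entry_multilinear k j)).
rewrite -wform_sum; congr (_ xs); apply/esym/eq_wform => zs hzs _.
exact: entry_cat.
Qed.

Lemma gprodZ b (F G : sform C p q) c d xs :
  gprod b (fun ys => c * F ys) (fun ys => d * G ys) xs = c * d * gprod b F G xs.
Proof.
rewrite /gprod -extZ; apply: eq_ext => ys _ _; rewrite mulr_sumr.
apply: eq_bigr => a _; rewrite mulrCA; congr (_ * _).
rewrite /wsum mulr_sumr; apply: eq_bigr => s _; rewrite /stensor; ring.
Qed.

Lemma permS1 (s : 'S_1) : s = 1%g.
Proof. by apply/permP => i; rewrite !ord1. Qed.

Lemma wsum1 b (H : hsform C p q) ys : wsum b 1 H ys = H [:: nth (hd0 C p q) ys 0].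
Proof.
rewrite /wsum (big_pred1 1%g) => [|s]; last by rewrite /= (permS1 s) eqxx.
rewrite /permk enum_ordSl enum_ord0 /= perm1 /weight odd_perm1 andbF.
by rewrite /koszul !big_ord1 ltnn !mul1r.
Qed.

(** In order one nothing is permuted, so both values of [b] give the same form and [coordf] can
    enter either product. *)
Lemma coordf_wform b i j : coordf i j = wform b 1 (entry i j).
Proof.
apply: funext => -[|X [|Y xs]] /=.
- by rewrite /wform ext_nil.
- rewrite /wform ext_cons big_bool !ext_nil /hform /= !wsum1 /entry /= !mulmx1.
  by rewrite -{1}(hpartD X) mxE.
rewrite -[LHS](@ext0 C p q [:: X, Y & xs]); apply: eq_ext => ys _ sys.
by rewrite /hform sys.
Qed.

Lemma wform0 b i j xs : wform b 0 (entry i j) xs = (i == j)%:R * unitf xs.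
Proof.
case: xs => [|X xs] /=.
  rewrite /wform ext_nil /hform /= /wsum (big_pred1 1%g) => [|s]; last first.
    by apply/esym/eqP/permP; case.
  by rewrite /permk enum_ord0 /entry !mxE /weight odd_perm1 andbF /koszul big_ord0 !mulr1 mul1r.
rewrite mulr0 -[RHS](@ext0 C p q (X :: xs)); apply: eq_ext => ys _ sys.
by rewrite /hform sys.
Qed.

Lemma sum_S2 (F : 'S_2 -> C) : \sum_s F s = F 1%g + F (tperm ord0 ord_max).
Proof.
have t1 : tperm (ord0 : 'I_2) ord_max != 1%g.
  by apply/eqP => /permP /(_ ord0); rewrite tpermL perm1.
rewrite (bigD1 1%g) // (bigD1 (tperm ord0 ord_max)) //= big1 ?addr0 // => s.
case/andP=> n1 nt; case/eqP: n1; apply/permP.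
have ord2 (i : 'I_2) : i = ord0 \/ i = ord_max.
  by case: i => [[|[|i]] lti] //; [left|right]; apply: val_inj.
case: (ord2 (s ord0)) => s0.
  move=> i; rewrite perm1; case: (ord2 i) => -> //.
  by case: (ord2 (s ord_max)) => // sm; have := perm_inj (etrans sm (esym s0)).
case/eqP: nt; apply/permP=> i; case: (ord2 i) => ->; rewrite ?tpermL ?tpermR //.
by case: (ord2 (s ord_max)) => // sm; have := perm_inj (etrans sm (esym s0)).
Qed.

(** In order two the only pair carries the sign $-1$, and the superbracket is the two-term skew
    supersymmetrisation of the product; all other orders vanish. *)
Lemma dd_coordf i j : dd (coordf i j) = fun xs => - wform true 2 (entry i j) xs.
Proof.
apply: funext => xs; rewrite -mulN1r -extZ; apply: eq_ext => -[|y1 [|y2 [|y3 ys]]] hys _ /=.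
- by rewrite big_ord0 /hform mulr0.
- by rewrite big_ord1 big_pred0 ?mulr0 // => k; rewrite (ord1 k).
- rewrite !big_ord_recl !big_ord0 /= big_mkcond !big_ord_recl !big_ord0 /=.
  rewrite !big_mkcond !big_ord_recl !big_ord0 /= !addr0 !add0r.
  rewrite !enum_ordSl enum_ord0 /=.
  have l01 : lift ord0 (ord0 : 'I_1) = ord_max :> 'I_2 by apply: val_inj.
  rewrite /hform /= /wsum sum_S2 /permk !enum_ordSl enum_ord0 /= !l01 !perm1 tpermL tpermR.
  rewrite /weight odd_perm1 odd_tperm /koszul !big_ord_recl !big_ord0 /= !l01.
  rewrite !perm1 !tpermL !tpermR /tags /entry /psum /sgn /= !mulmx1 addbF addbb !andbF !mxE.
  by rewrite [y2.2 && _]andbC; ring.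
rewrite /hform /= mulr0; apply: big1 => i0 _; apply: big1 => j0 _.
(* If an argument remains beside the bracket, [coordf] vanishes. None remaining would mean that [i0]
   and [j0] exhaust at least three indices, which the list [o] refutes. *)
case E: [seq _ | _ <- _ & _] => [|y s]; last by rewrite mulr0.
have /(congr1 size) /eqP := E; rewrite size_map size_filter -leqn0 leqNgt -has_count.
move/hasPn => all_ij; pose o := [:: ord0; inord 1; inord 2] : seq 'I_(size ys).+3.
have o_uniq : uniq o.
  by rewrite /= !inE negb_or -!val_eqE /= !inordK.
suff /(uniq_leq_size o_uniq) : {subset o <= [:: i0; j0]} by [].
move=> k _; move: (all_ij k (mem_enum _ _)).
by rewrite negb_and !negbK !inE.
Qed.

End MatrixEntries.

(** * Supercyclicity of the supertrace *)

Section SuperTrace.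
Variables (C : numClosedFieldType) (p q : nat).
Local Notation n := (p + q)%N.
Local Notation M := 'M[C]_n.
Local Notation hd0 := (hd0 C p q).
Local Notation homogs := (all (@homog C p q)).
Local Notation par i j := (@ipar p q i (+) @ipar p q j).

Definition hstr : hsform C p q := fun ys => str (mprod (map fst ys)).

Lemma hstrE ys : hstr ys = \sum_(i < n) (-1) ^+ ipar i * entry i i ys.
Proof. by []. Qed.

Lemma hstr_multilinear : hmultilinear hstr.
Proof.
move=> us vs b c X Y; rewrite !hstrE mulr_sumr -big_split; apply: eq_bigr => i _.
by rewrite entry_multilinear /=; ring.
Qed.

(** A nonzero term $X_{ij}Y_{ji}$ forces both degrees to be $|i|+|j|$, and $(-1)^{|i|+|j|}$ is the
    ratio of the supertrace signs at $i$ and $j$. *)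
Lemma str_mulC (X Y : M) b c : homog (X, b) -> homog (Y, c) ->
  str (X *m Y) = (-1) ^+ (b && c) * str (Y *m X).
Proof.
move=> hX hY; rewrite /str mulr_sumr.
under eq_bigr do rewrite mxE mulr_sumr.
under [RHS]eq_bigr do rewrite mxE !mulr_sumr.
rewrite exchange_big; apply: eq_bigr => j _; apply: eq_bigr => i _ /=.
have [ib|] := eqVneq (par i j) b; last first.
  by move=> /(homog_entry0 hX) ->; rewrite !(mulr0, mul0r).
have [ic|] := eqVneq (par j i) c; last first.
  by move=> /(homog_entry0 hY) ->; rewrite !(mulr0, mul0r).
rewrite -ib -ic [par j i]addbC andbb /sgn signr_addb.
by rewrite [X i j * _]mulrC !mulrA -!signr_addb addbK.
Qed.

Definition cycle_perm m : 'S_m.+1 := perm (@ordS_inj m.+1).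

Lemma cycle_perm_max m : cycle_perm m ord_max = ord0.
Proof. by apply: val_inj; rewrite permE /= modnn. Qed.

Lemma cycle_perm_widen m (i : 'I_m) : cycle_perm m (widen_ord (leqnSn m) i) = lift ord0 i.
Proof. by apply: val_inj; rewrite permE /= modn_small // ltnS. Qed.

(** The sign for moving an argument of degree [b] past the whole of [zs]. *)
Lemma psum_pairing (b : bool) (zs : seq (M * bool)) :
  \prod_(i < size zs) (-1) ^+ ((nth hd0 zs i).2 && b) = (-1) ^+ (b && psum zs) :> C.
Proof.
elim: zs => [|z zs IHzs]; first by rewrite big_ord0 andbF.
by rewrite big_ord_recl /= IHzs -signr_addb [X in _ = (_ ^+ nat_of_bool X)]andb_addr andbC.
Qed.

(** The inversions of the cycle are the pairs made of the last position, which receives [y], and any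
    earlier one. *)
Lemma koszul_cycle m (y : M * bool) zs : size zs = m ->
  koszul C (tags (y :: zs)) (cycle_perm m) = (-1) ^+ (y.2 && psum zs).
Proof.
move=> <-; rewrite /koszul big_ord_recr /= [X in _ * X]big1 ?mulr1 => [|j _]; last first.
  by rewrite ltnNge -ltnS ltn_ord.
rewrite -psum_pairing; apply: eq_bigr => i _.
rewrite big_ord_recr /= big1 ?mul1r => [|j _]; last first.
  rewrite !cycle_perm_widen /= /bump !add1n ltnS; case: ltngtP => //.
by rewrite cycle_perm_max cycle_perm_widen ltn_ord.
Qed.

Lemma permk_cycle m (y : M * bool) zs :
  size zs = m -> permk (y :: zs) (cycle_perm m) = rcons zs y.
Proof.
move=> szs; apply: (@eq_from_nth _ hd0) => [|i]; first by rewrite size_permk size_rcons szs.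
rewrite size_permk => im; rewrite -[i]/(val (Ordinal im)) nth_permk nth_rcons szs.
case: (unliftP ord_max (Ordinal im)) => [j|] ->.
  have -> : lift ord_max j = widen_ord (leqnSn m) j.
    by apply: val_inj; rewrite /= /bump leqNgt ltn_ord.
  by rewrite cycle_perm_widen /= ltn_ord.
by rewrite cycle_perm_max /= ltnn eqxx.
Qed.

(** The Koszul sign for moving the head to the end equals the sign of supercyclicity, and the two
    cancel. *)
Lemma hstr_cycle m ys : homogs ys -> size ys = m.+1 ->
  weight C false (tags ys) (cycle_perm m) * hstr (permk ys (cycle_perm m)) = hstr ys.
Proof.
case: ys => // y zs /andP[hy hzs] [szs].
rewrite /weight mul1r koszul_cycle // permk_cycle // /hstr map_rcons -cats1 mprod_cat /=.
rewrite mulmx1 [RHS](@str_mulC _ _ y.2 (psum zs)) ?homog_mprod //; case: (y) hy.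
Qed.

Lemma sum_perm_fix0 m (F : 'S_m.+1 -> C) :
  \sum_(s : 'S_m.+1 | s ord0 == ord0) F s = \sum_(t : 'S_m) F (@block_perm 1 m 1 t).
Proof.
have lsh0 : ord0 = lshift m (ord0 : 'I_1) :> 'I_(1 + m) by apply: val_inj.
rewrite -(@big_imset _ _ _ _ _ (fun t => @block_perm 1 m 1 t) xpredT F) /=; last first.
  move=> t t' _ _ tt'; apply/permP=> i; apply: (@rshift_inj 1).
  by rewrite -!(block_perm_rshift 1) tt'.
apply: eq_bigl => s; apply/eqP/imsetP => [s0|[t _ ->]]; last first.
  by have := @block_perm_lshift 1 m 1 t ord0; rewrite perm1 -lsh0.
(* By injectivity, a permutation fixing the first point maps the others among themselves; [g] is the
   induced map. *)
have sr (j : 'I_m) : exists k : 'I_m, s (rshift 1 j) == rshift 1 k :> 'I_(1 + m).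
  case: (split_ordP (s (rshift 1 j) : 'I_(1 + m))) => k sjk; last by exists k; rewrite sjk.
  have : s (rshift 1 j) = s ord0 by rewrite s0 sjk (ord1 k) lsh0.
  by move/perm_inj/(congr1 val).
pose g j := xchoose (sr j).
have gP j : s (rshift 1 j) = rshift 1 (g j) :> 'I_(1 + m) by apply/eqP/(xchooseP (sr j)).
have g_inj : injective g.
  move=> j j' gjj'; apply: (@rshift_inj 1); apply: (@perm_inj _ s).
  by rewrite !gP gjj'.
exists (perm g_inj) => //; apply/permP => i; case: (split_ordP (i : 'I_(1 + m))) => j ->.
  by rewrite block_perm_lshift perm1 (ord1 j) -lsh0.
by rewrite block_perm_rshift gP permE.
Qed.

(** Permutations are sorted by the position [r] at which [y] lands. Rotation invariance makes the
    $m+1$ classes contribute equally, and the class with [y] in front is a symmetrisation over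
    [ys]. *)
Lemma wsum_hstr_cons (m : nat) y ys : homogs (y :: ys) -> size ys = m ->
  wsum false m.+1 hstr (y :: ys)
  = m.+1%:R * wsum false m (fun zs => hstr (y :: zs)) ys.
Proof.
move=> hys szs; pose F (s : 'S_m.+1) := weight C false (tags (y :: ys)) s
  * hstr (permk (y :: ys) s).
pose f r := \sum_(s : 'S_m.+1 | s r == ord0) F s.
have fS r : f (ordS r) = f r.
  rewrite /f [RHS](reindex_inj (mulgI (cycle_perm m))).
  apply: eq_big => [s|s _]; first by rewrite permM permE.
  rewrite /F weightM permkM [_ * weight _ _ _ s]mulrC -[RHS]mulrA; congr (_ * _).
  rewrite -[LHS](@hstr_cycle m) ?size_permk ?homog_permk //= ?szs //.
  by congr (_ * _ * _); apply: eq_koszul => i; rewrite tags_permk.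
have f0 r : f r = f ord0.
  case: r => r; elim: r => [|r IHr] rm; first by congr f; apply: val_inj.
  rewrite -(IHr (ltnW rm)) -[RHS]fS; congr f; apply: val_inj; rewrite /= modn_small //.
have -> : wsum false m.+1 hstr (y :: ys) = \sum_r f r.
  rewrite /f (exchange_big_dep xpredT) //=; apply: eq_bigr => s _.
  by rewrite (big_pred1 (s^-1%g ord0)) // => r; rewrite /= -(inj_eq (@perm_inj _ s) r) permKV.
rewrite (eq_bigr (fun=> f ord0)) // sumr_const card_ord -[LHS]mulr_natl; congr (_ * _).
have st : size (y :: ys) = (1 + m)%N by rewrite /= szs.
rewrite /f sum_perm_fix0; apply: eq_bigr => t _; rewrite /F.
have -> : weight C false (tags (y :: ys)) (@block_perm 1 m 1 t)
    = weight C false (tags ys) t.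
  rewrite [LHS](@weight_block C false 1 m) {1}/weight odd_perm1 mul1r.
  by rewrite /koszul !big_ord1 ltnn mul1r.
congr (_ * _); congr hstr; rewrite [LHS](permk_block _ _ st) /= drop0 take0.
by rewrite {1}/permk enum_ordSl enum_ord0 /= perm1.
Qed.

End SuperTrace.

(** * Transgression *)

Section Transgression.
Variables (C : numClosedFieldType) (p q : nat).
Local Notation n := (p + q)%N.
Local Notation M := 'M[C]_n.
Local Notation homogs := (all (@homog C p q)).
Local Notation par i j := (@ipar p q i (+) @ipar p q j).

Lemma Pk_wform k : Pk k = wform false k (@hstr C p q).
Proof.
apply: funext => xs; apply: eq_ext => ys _ _; rewrite /hform; case: eqP => // <-.
by apply: eq_bigr => s _; rewrite epsE /weight mul1r.
Qed.

Lemma Lk_wform k : Lk k = wform true k (@hstr C p q).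
Proof.
apply: funext => xs; apply: eq_ext => ys _ _; rewrite /hform; case: eqP => // <-.
by apply: eq_bigr => s _; rewrite epsE.
Qed.

Lemma wform_hstr b k xs :
  wform b k (@hstr C p q) xs = \sum_i (-1) ^+ ipar i * wform b k (entry i i) xs.
Proof. by rewrite -wform_sum. Qed.

Lemma homog_delta (i j : 'I_n) : homog (delta_mx i j : M, par i j).
Proof.
apply/eqP/matrixP => a b; rewrite !mxE /=; case: eqP => // nab.
by case: eqP => //= ai; case: eqP => // bj; rewrite ai bj in nab.
Qed.

Lemma hstr_delta (i j : 'I_n) b ys :
  hstr ((delta_mx i j : M, b) :: ys) = (-1) ^+ ipar i * entry j i ys.
Proof.
rewrite /hstr /str (bigD1 i) //= big1 ?addr0 => [|k ki]; rewrite mxE.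
  rewrite (bigD1 j) //= big1 ?addr0 => [|l lj]; first by rewrite mxE !eqxx mul1r.
  by rewrite mxE (negPf lj) andbF mul0r.
by rewrite big1 ?mulr0 // => l _; rewrite mxE (negPf ki) mul0r.
Qed.

(** The factor $m+1$ comes from supercyclicity and $(-1)^{|i|}$ from the supertrace. The sign in
    [Dder] is trivial wherever the entry is nonzero, since the remaining arguments then have the
    total degree of $E_{ij}$. *)
Lemma Dder_Pk (m : nat) (i j : 'I_n) :
  Dder (delta_mx i j) (par i j) (Pk m.+1)
  = fun xs => (m.+1%:R * (-1) ^+ ipar i) * wform false m (@entry C p q j i) xs.
Proof.
apply: funext => xs; rewrite -extZ Pk_wform; apply: eq_ext => ys hys _.
have hEys : homogs ((delta_mx i j : M, par i j) :: ys) by rewrite /= homog_delta.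
rewrite -[_ :: map _ _]/(map fst ((delta_mx i j : M, par i j) :: ys)).
rewrite wform_homog ?hEys //; last exact: hstr_multilinear.
rewrite /hform /= eqSS; case: eqP => [sys|_]; last by rewrite !mulr0.
rewrite wsum_hstr_cons // /wsum !mulr_sumr; apply: eq_bigr => t _.
rewrite hstr_delta; have [pE|] := eqVneq (par j i) (psum (permk ys t)).
  rewrite (psum_perm (perm_permk t sys)) addbC in pE.
  by rewrite -pE addbb andbF /sgn; ring.
by move=> /entry0 -> //; rewrite ?homog_permk // !mulr0.
Qed.

Lemma inP_linear (F G : sform C p q) c :
  inP F -> inP G -> inP (fun xs => c * F xs + G xs).
Proof.
move=> [linF symF] [linG symG]; split=> [xs ys d X Y|ys hys t].
  by rewrite linF linG; ring.
by rewrite -(symF ys hys t) -(symG ys hys t); ring.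
Qed.

Lemma inP0 : inP ((fun=> 0) : sform C p q).
Proof. by split=> [xs ys d X Y|ys hys t]; rewrite ?mulr0 ?addr0. Qed.

Lemma inP_coordf (i j : 'I_n) : inP (coordf i j : sform C p q).
Proof. by rewrite (coordf_wform C false); apply/wform_inP/entry_multilinear. Qed.

Lemma htensor_multilinear a (H1 H2 : hsform C p q) :
  hmultilinear H1 -> hmultilinear H2 -> hmultilinear (htensor a H1 H2).
Proof.
move=> lin1 lin2 us vs b c X Y; rewrite /htensor !take_cat !drop_cat.
case: ltnP => [_|le_a].
  have psE Z : psum (drop a us ++ (Z, b) :: vs) = psum (drop a us ++ (X, b) :: vs) :> bool.
    by rewrite /psum !map_cat.
  by rewrite !psE lin2; ring.
case: (a - size us)%N => [|r] /=.
  rewrite -[(c *: X + Y, b) :: vs]cat0s lin2 !cat0s !cats0.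
  by rewrite -![psum ((_, b) :: vs)]/(b (+) psum vs); ring.
have psE Z : psum (us ++ (Z, b) :: take r vs) = psum (us ++ (X, b) :: take r vs).
  by rewrite /psum !map_cat.
by rewrite !psE lin1; ring.
Qed.

(** * The morphism [s] on entry forms *)

Variable s : sform C p q -> sform C p q.
Hypothesis sP : is_s s.

Lemma s_zero : s (fun=> 0) = fun=> 0.
Proof.
have [s_lin _ _ _] := sP; apply: funext => xs.
have := s_lin _ _ 1 inP0 inP0 xs; rewrite /= !mul1r addr0.
by move/eqP; rewrite -subr_eq subrr => /eqP <-.
Qed.

Lemma s_scale c (F : sform C p q) : inP F ->
  s (fun xs => c * F xs) = fun xs => c * s F xs.
Proof.
have [s_lin _ _ _] := sP; move=> FP; apply: funext => xs.
have := s_lin _ _ c FP inP0 xs; rewrite s_zero addr0 => <-.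
by congr (s _ xs); apply: funext => ys; rewrite addr0.
Qed.

Lemma s_sum (I : finType) (c : I -> C) (F : I -> sform C p q) :
  (forall i, inP (F i)) ->
  s (fun xs => \sum_i c i * F i xs) = fun xs => \sum_i c i * s (F i) xs.
Proof.
have [s_lin _ _ _] := sP; move=> FP.
(* Membership of the partial sums in $\mathcal P(\mathfrak g)$ is carried through the induction,
   because linearity of [s] is only available there. *)
suff [] : inP (fun xs => \sum_i c i * F i xs) /\
    s (fun xs => \sum_i c i * F i xs) = fun xs => \sum_i c i * s (F i) xs by [].
elim: (index_enum I) => [|i r [IHP IHs]].
  have E (G : I -> sform C p q) : (fun xs => \sum_(i <- [::]) c i * G i xs) = fun=> 0.
    by apply: funext => xs; rewrite big_nil.
  by rewrite !E s_zero; split=> //; apply: inP0.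
have E (G : I -> sform C p q) : (fun xs => \sum_(i <- i :: r) c i * G i xs)
    = fun xs => c i * G i xs + \sum_(i <- r) c i * G i xs.
  by apply: funext => xs; rewrite big_cons.
rewrite !E; split; first exact: inP_linear.
by apply: funext => xs; rewrite s_lin // IHs.
Qed.

Lemma s_coordf (i j : 'I_n) :
  s (coordf i j) = fun xs => -1 * wform true 2 (entry i j) xs.
Proof.
have [_ _ _ s_dual] := sP; apply: funext => xs; rewrite s_dual.
- by rewrite dd_coordf mulN1r.
- by case: (inP_coordf i j).
- by case=> [|? []].
Qed.

(** Induction on [m], splitting off one matrix factor: [s] turns it into $-W_2$, and the wedge
    products with $W_{2m}$ reassemble into $W_{2m+2}$. *)
Lemma s_entry m (i j : 'I_n) :
  s (wform false m (entry i j)) = fun xs => (-1) ^+ m * wform true (2 * m) (entry i j) xs.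
Proof.
have [_ s_mul s_unit _] := sP; elim: m i j => [|m IHm] i j.
  (* The unit is a diagonal entry form of order zero, hence lies in $\mathcal P(\mathfrak g)$. *)
  have unitE k : unitf (C := C) (q := q) = wform false 0 (@entry C p q k k).
    by apply: funext => xs; rewrite wform0 eqxx mul1r.
  have -> : wform false 0 (entry i j) = fun xs => (i == j)%:R * @unitf C p q xs.
    by apply: funext => xs; rewrite wform0.
  rewrite s_scale; last by rewrite (unitE i); apply/wform_inP/entry_multilinear.
  by apply: funext => xs; rewrite s_unit wform0 mul1r.
have -> : wform false m.+1 (@entry C p q i j) = fun xs => \sum_k (-1) ^+ (par i k && par k j)
    * Defs.fprod (coordf i k) (wform false m (entry k j)) xs.
  apply: funext => xs; rewrite -[m.+1]/(1 + m)%N -wform_entry_mul.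
  by apply: eq_bigr => k _; rewrite fprod_gprod (coordf_wform C false).
rewrite s_sum => [|k]; last first.
  rewrite fprod_gprod (coordf_wform C false) gprod_wform; try exact: entry_multilinear.
  by apply/wform_inP/htensor_multilinear; apply: entry_multilinear.
apply: funext => xs; rewrite mulnS -wform_entry_mul mulr_sumr; apply: eq_bigr => k _.
rewrite s_mul; [|exact: inP_coordf|exact/wform_inP/entry_multilinear].
by rewrite s_coordf IHm fwedge_gprod gprodZ exprS; ring.
Qed.

(** Both sides agree term by term in $i,j$: $(-1)^{|i|}$ from [Dder_Pk] is the supertrace sign of
    $\Lambda_{2m+1}$, and the transgression sign $(-1)^{|i|+|j|}$ is the one arising when the first
    factor of $W_{2m+1}^{ii}$ is split off. *)
Lemma transg_Pk m xs :
  transg s (Pk m.+1) xs = (-1) ^+ m * m.+1%:R * Lk (2 * m).+1 xs.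
Proof.
rewrite Lk_wform wform_hstr mulr_sumr; apply: eq_bigr => i _.
rewrite -[(2 * m).+1]/(1 + 2 * m)%N -wform_entry_mul !mulr_sumr; apply: eq_bigr => j _.
rewrite Dder_Pk s_scale; last exact/wform_inP/entry_multilinear.
(* The scalars of [Dder_Pk] and [s_entry] leave the wedge product together; the left factor is given
   the scalar $1$. *)
have := @gprodZ C p q true (coordf i j) (wform true (2 * m) (entry j i)) 1
  (m.+1%:R * (-1) ^+ ipar i * (-1) ^+ m) xs.
rewrite s_entry fwedge_gprod (coordf_wform C true) [par j i]addbC andbb /sgn => E.
rewrite [LHS](_ : _ = (-1) ^+ par i j * (1 * (m.+1%:R * (-1) ^+ ipar i * (-1) ^+ m) *
  gprod true (wform true 1 (entry i j)) (wform true (2 * m) (entry j i)) xs)); first by ring.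
rewrite -E; congr (_ * gprod _ _ _ _); apply: funext => ys; first by rewrite mul1r.
by ring.
Qed.

End Transgression.

Theorem theorem4p1 (C : numClosedFieldType) (p q k : nat)
    (s : sform C p q -> sform C p q) :
  (1 <= k)%N -> is_s s ->
  forall xs : seq 'M[C]_(p + q),
    transg s (Pk k) xs = (-1) ^+ k.-1 * k%:R * Lk (2 * k - 1) xs.
Proof.
case: k => // m _ sP xs; rewrite transg_Pk //.
by rewrite mulnS add2n subn1.
Qed.
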